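(* The polynomials $P_n$ satisfy $P_1=x_1-1$, $P_2=x_2-x_1$, and for every $n\ge 3$ $P_n(x_1,\dots,x_n)=P_{n-1}\bigl(x_1,\dots,x_{n-2},\,x_{n-1}x_n-y_{n-1}y_n\bigr)\cdot P_{n-1}\bigl(x_1,\dots,x_{n-2},\,x_{n-1}x_n+y_{n-1}y_n\bigr)$; in particular this recursion completely determines all $P_n$.
   Context: Let $x_1,\dots,x_n$ be algebraically independent indeterminates over $\mathbb{Q}$; in an algebraic closure fix $y_j$ with $y_j^2=1-x_j^2$. For indices $i_1<\dots<i_m$, $\mathrm{EC}_m(x_{i_1},\dots,x_{i_m})=\sum_{S\subseteq\{i_1,\dots,i_m\},\ |S|\text{ even}}(-1)^{|S|/2}\prod_{j\in S}y_j\prod_{j\notin S}x_j$ (so $\mathrm{EC}_2(x_{n-1},x_n)=x_{n-1}x_n-y_{n-1}y_n$). For $k\ge2$, $G_{k-1}$ is the Galois group of $\mathbb{Q}(x_1,\dots,x_k,\ y_iy_j:1\le i<j\le k-1)$ over $\mathbb{Q}(x_1,\dots,x_k)$, $P_1=x_1-1$ and $P_k(x_1,\dots,x_k)=\prod_{\sigma\in G_{k-1}}(x_k-\sigma(\mathrm{EC}_{k-1}(x_1,\dots,x_{k-1})))\in\mathbb{Q}[x_1,\dots,x_k]$. In the recursion, $P_{n-1}$ is evaluated as a polynomial at the indicated arguments. *)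

(* Defs.v *)
From HB Require Import structures.
From mathcomp Require Import all_boot all_order all_algebra.
Set Implicit Arguments. Unset Strict Implicit. Unset Printing Implicit Defensive.
Import Order.TTheory GRing.Theory Num.Theory.
Local Open Scope ring_scope.

(* Multivariate polynomials over Q in the variables x_1, ..., x_n, represented
   as iterated univariate polynomials: mp (n+1) = (mp n)[x_{n+1}]. *)
Fixpoint mp (n : nat) : idomainType :=
  if n is n'.+1 then ({poly mp n'} : idomainType) else (rat : idomainType).

Fixpoint Xv (n i : nat) : mp n :=
  match n return mp n with
  | 0 => 0
  | n'.+1 => if i == n'.+1 then ('X : {poly mp n'})
             else ((Xv n' i)%:P : {poly mp n'})
  end.

Fixpoint meval (L : fieldType) (n : nat) : mp n -> (nat -> L) -> L :=
  match n return mp n -> (nat -> L) -> L with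
  | 0 => fun c _ => ratr c
  | n'.+1 => fun (p : {poly mp n'}) a =>
      \sum_(i < size p) meval p`_i a * a n'.+1 ^+ i
  end.

Definition alg_indep (L : fieldType) (n : nat) (x : nat -> L) : Prop :=
  forall p : mp n, meval p x = 0 -> p = 0.

Definition in_gen_field (L : fieldType) (gs : seq L) (z : L) : Prop :=
  exists p q : mp (size gs),
    let a := fun i => nth 0 gs i.-1 in
    meval q a != 0 /\ z = meval p a / meval q a.

Definition genK (L : fieldType) (x : nat -> L) (k : nat) : seq L :=
  map x (iota 1 k).

Definition genE (L : fieldType) (x y : nat -> L) (k : nat) : seq L :=
  genK x k ++
  [seq y p.1 * y p.2 | p <- [seq p <- [seq (i, j) | i <- iota 1 k.-1,
                                                     j <- iota 1 k.-1]
                             | (p.1 < p.2)%N]].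

Definition is_rel_aut (L : fieldType) (inE inK : L -> Prop) (s : L -> L) : Prop :=
  [/\ forall z, inE z -> inE (s z),
      forall z w, inE z -> inE w -> s (z + w) = s z + s w /\ s (z * w) = s z * s w,
      s 1 = 1 /\ s 0 = 0,
      (forall z w, inE z -> inE w -> s z = s w -> z = w) /\
      (forall w, inE w -> exists2 z, inE z & s z = w)
    & forall z, inK z -> s z = z].

Definition agree_on (L : fieldType) (inE : L -> Prop) (s t : L -> L) : Prop :=
  forall z, inE z -> s z = t z.

Definition gal_enum (L : fieldType) (inE inK : L -> Prop) (ss : seq (L -> L)) : Prop :=
  [/\ forall i, (i < size ss)%N -> is_rel_aut inE inK (nth id ss i),
      forall i j, (i < size ss)%N -> (j < size ss)%N -> i <> j ->
        ~ agree_on inE (nth id ss i) (nth id ss j)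
    & forall s, is_rel_aut inE inK s ->
        exists2 i, (i < size ss)%N & agree_on inE s (nth id ss i)].

(* G_{k-1} := Gal(Q(x_1..x_k, y_i y_j : i<j<=k-1) / Q(x_1..x_k)). *)
Definition G_enum (L : fieldType) (x y : nat -> L) (k : nat) (ss : seq (L -> L)) :=
  gal_enum (in_gen_field (genE x y k)) (in_gen_field (genK x k)) ss.

(* EC_m(x_1, ..., x_m), subsets of {1..m} encoded as subsets S of 'I_m via j |-> j+1. *)
Definition EC (L : fieldType) (x y : nat -> L) (m : nat) : L :=
  \sum_(S : {set 'I_m} | ~~ odd #|S|)
     (-1) ^+ (#|S|./2) * (\prod_(j in S) y j.+1) * (\prod_(j in ~: S) x j.+1).

Definition rec_pt (L : fieldType) (x y : nat -> L) (n : nat) (e : L) : nat -> L :=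
  fun i => if i == n.-1 then x n.-1 * x n + e * (y n.-1 * y n) else x i.

(* Main.v *)
Require Import Defs.
From HB Require Import structures.
From mathcomp Require Import all_boot all_order all_algebra.
From mathcomp Require Import ring zify.
From Stdlib Require Import ClassicalEpsilon.
Set Implicit Arguments. Unset Strict Implicit. Unset Printing Implicit Defensive.
Import GRing.Theory Num.Theory.
Local Open Scope ring_scope.

(* No product of distinct y_j lies in K = Q(x_1, ..., x_k), since the matching
   product of the 1 - x_j^2 is not a square. Hence every choice of signs y_j -> +-y_j
   extends to an automorphism over K of K(y_1, ..., y_{k-1}), an iterated quadratic
   extension; up to a global sign these exhaust G_{k-1}, so P_k is the product of
   x_k - EC_{k-1}(x, +-y) over sign vectors whose first sign is +. With i^2 = -1,
   2 EC_m = Z + W where Z, W = prod_j (x_j +- i y_j) and Z W = 1, so the two factors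
   that differ in the last sign multiply to
   (x_{n-1} x_n - EC_{n-2})^2 - (y_{n-1} y_n)^2, which is the recursion.
   P_{n-1} may be evaluated at the new last argument because x_{n-1} is
   transcendental over Q(x_j, y_j : j < n-1). *)

(** * Evaluation of iterated polynomials as a ring morphism in characteristic zero *)

Section CharZero.
Variable (L : fieldType).
Hypothesis L0 : [pchar L] =i pred0.

Lemma intr_eq0_pchar0 (m : int) : (m%:~R == 0 :> L) = (m == 0).
Proof.
have nat0 n : (n%:R == 0 :> L) = (n == 0%N) by move/pcharf0P: L0 => ->.
by case: m => n; rewrite ?NegzE ?mulrNz ?oppr_eq0 -pmulrn nat0.
Qed.

(** [ratr] is computed from the reduced numerator and denominator. Cross-multiplication reaches any
    other fraction because nonzero integers stay nonzero in [L]. *)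
Lemma ratr_frac_pchar0 (a b : int) :
  b != 0 -> ratr (a%:~R / b%:~R) = a%:~R / b%:~R :> L.
Proof.
move=> b0; set z := _ / _.
have bz : b%:~R != 0 :> rat by rewrite intr_eq0.
have E : numq z * b = a * denq z.
  apply: (@intr_inj rat); rewrite !rmorphM /= numqE {1}/z.
  by rewrite mulrAC divfK.
apply/eqP; rewrite /ratr eqr_div ?intr_eq0_pchar0 ?denq_eq0 //.
by rewrite -!rmorphM /= E.
Qed.

Lemma ratr_is_zmod_pchar0 : zmod_morphism (@ratr L).
Proof.
move=> x y; rewrite -[x]divq_num_den -[y]divq_num_den.
have dx := denq_neq0 x; have dy := denq_neq0 y.
rewrite -mulNr -mulrNz addf_div ?intr_eq0 // -!intrM -intrD.
rewrite !ratr_frac_pchar0 ?mulf_neq0 // -mulNr -mulrNz.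
by rewrite addf_div ?intr_eq0_pchar0 // -!intrM -intrD.
Qed.

Lemma ratr_is_monoid_pchar0 : monoid_morphism (@ratr L).
Proof.
split=> [|x y]; first by rewrite /ratr divr1.
rewrite -[x]divq_num_den -[y]divq_num_den.
have dx := denq_neq0 x; have dy := denq_neq0 y.
rewrite mulf_div -!intrM !ratr_frac_pchar0 ?mulf_neq0 //.
by rewrite mulf_div -!intrM.
Qed.

Lemma mevalE k (p : mp k.+1) (a : nat -> L) :
  meval p a = (map_poly (fun q => @meval L k q a) p).[a k.+1].
Proof. by rewrite /map_poly horner_poly. Qed.

(** The algebraic laws of [meval] all come from this packing. The morphism is built by induction:
    map the coefficients, then evaluate the last variable. The base case [ratr] is where
    characteristic zero enters. *)
Lemma meval_rmorphism k (a : nat -> L) :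
  exists g : {rmorphism mp k -> L}, forall p, meval p a = g p.
Proof.
elim: k => [|k [g gE]].
  pose R := GRing.isZmodMorphism.Build rat L _ ratr_is_zmod_pchar0.
  pose M := GRing.isMonoidMorphism.Build rat L _ ratr_is_monoid_pchar0.
  pose f : {rmorphism rat -> L} := HB.pack (@ratr L) R M.
  by exists f.
exists (horner_eval (a k.+1) \o map_poly g : {rmorphism {poly mp k} -> L}).
move=> p; rewrite mevalE /= /horner_eval; congr (_.[_]).
by apply: eq_map_poly => q; apply: gE.
Qed.


Lemma meval0 k a : meval (0 : mp k) a = 0 :> L.
Proof. by have [g ->] := meval_rmorphism k a; rewrite rmorph0. Qed.

Lemma meval1 k a : meval (1 : mp k) a = 1 :> L.
Proof. by have [g ->] := meval_rmorphism k a; rewrite rmorph1. Qed.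

Lemma mevalB k (p q : mp k) a : meval (p - q) a = meval p a - meval q a :> L.
Proof. by have [g gE] := meval_rmorphism k a; rewrite !gE rmorphB. Qed.

Lemma mevalM k (p q : mp k) a : meval (p * q) a = meval p a * meval q a :> L.
Proof. by have [g gE] := meval_rmorphism k a; rewrite !gE rmorphM. Qed.

Lemma meval_prod k (I : Type) (r : seq I) (P : pred I) (F : I -> mp k) a :
  meval (\prod_(i <- r | P i) F i) a = \prod_(i <- r | P i) meval (F i) a :> L.
Proof.
have [g gE] := meval_rmorphism k a; rewrite gE rmorph_prod.
by apply: eq_bigr => i _; rewrite gE.
Qed.

Lemma mevalC k (p : mp k) a : @meval L k.+1 (p%:P) a = meval p a.
Proof.
have [g gE] := meval_rmorphism k a.
by rewrite mevalE (eq_map_poly gE) map_polyC hornerC /= gE.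
Qed.

Lemma mevalX k a : @meval L k.+1 'X a = a k.+1.
Proof.
have [g gE] := meval_rmorphism k a.
by rewrite mevalE (eq_map_poly gE) map_polyX hornerX.
Qed.

Lemma meval_Xv k i a : (0 < i <= k)%N -> meval (Xv k i) a = a i :> L.
Proof.
elim: k => [|k IH] /=; first by case: i.
case/andP=> i0 ik; have [->|ni] := eqVneq i k.+1; first exact: mevalX.
by rewrite -[LHS]/(@meval L k.+1 ((Xv k i)%:P) a) mevalC IH // i0 -ltnS ltn_neqAle ni.
Qed.

Lemma eq_meval k (p : mp k) (a b : nat -> L) :
  (forall i, (0 < i <= k)%N -> a i = b i) -> meval p a = meval p b.
Proof.
elim: k p => [|k IH] p ab //=; apply: eq_bigr => i _.
rewrite (IH _ _) ?ab ?leqnn // => j /andP[j0 jk].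
by rewrite ab // j0 leqW.
Qed.

(** A relation among fewer variables is a relation among all of them, constant in the last one. *)
Lemma alg_indep_leq n k (x : nat -> L) :
  (k <= n)%N -> alg_indep n x -> alg_indep k x.
Proof.
move=> kn; elim: n kn => [|n IH]; first by rewrite leqn0 => /eqP->.
rewrite leq_eqVlt => /predU1P[-> //|kn xn]; apply: IH => // p px.
by apply: (@polyC_inj (mp n)); apply: xn; rewrite mevalC.
Qed.

Lemma alg_indep_inj n (x : nat -> L) (p q : mp n) :
  alg_indep n x -> meval p x = meval q x -> p = q.
Proof.
by move=> xn pq; apply/eqP; rewrite -subr_eq0; apply/eqP/xn; rewrite mevalB pq subrr.
Qed.

End CharZero.

(** * Products of the 1 - x_j^2 are not squares *)

Lemma mp_natr_eq0 k m : (m%:R == 0 :> mp k) = (m == 0%N).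
Proof.
elim: k => [|k IH]; first exact: pnatr_eq0.
by rewrite -[LHS]/(m%:R == 0 :> {poly mp k}) -polyC_natr polyC_eq0 IH.
Qed.

(** Descent on the size of [q]: since 2 and [c] are nonzero, 1 - X^2 has a simple zero at 1, so X -
    1 divides [p] and then [q]. Cancelling (X - 1)^2 leaves the same equation with a smaller [q]. *)
Lemma mul_1subX2_nonsquare (R : idomainType) (p q : {poly R}) (c : R) :
  2%:R != 0 :> R -> c != 0 -> p ^+ 2 = q ^+ 2 * ((1 - 'X ^+ 2) * c%:P) -> q = 0.
Proof.
move=> two0 c0; have [m] := ubnP (size q); elim: m p q => // m IH p q qm E.
have X1 : 'X - 1%:P != 0 :> {poly R} by rewrite polyXsubC_eq0.
have /factor_theorem[p1 Ep] : root p 1.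
  have /eqP : p.[1] ^+ 2 = 0.
    by rewrite -horner_exp E !hornerE expr1n subrr /= mulr0 mul0r.
  by rewrite expf_eq0.
have E1 : p1 ^+ 2 * ('X - 1%:P) = - (q ^+ 2 * (('X + 1) * c%:P)).
  apply: (mulIf X1); rewrite -mulrA -expr2 -exprMn -Ep E !polyC1; ring.
have /factor_theorem[q1 Eq] : root q 1.
  move/(congr1 (horner^~ 1)): E1; rewrite !hornerE subrr mulr0.
  move/esym/eqP; rewrite oppr_eq0 !mulf_eq0 (negPf c0) -(natrD _ 1 1) (negPf two0).
  by rewrite !orbF orbb.
have E2 : p1 ^+ 2 = q1 ^+ 2 * ((1 - 'X ^+ 2) * c%:P).
  apply: (mulIf X1); rewrite E1 Eq !polyC1; ring.
have [q10|q10] := eqVneq q1 0; first by rewrite Eq q10 mul0r.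
rewrite Eq (IH _ _ _ E2) ?mul0r //.
by move: qm; rewrite Eq size_Mmonic ?monicXsubC // size_XsubC addn2.
Qed.

(** Induction on the number of variables. If [b] selects the last one, the one-variable lemma
    applies with [c] the product over the others. If not, the product is constant in the last
    variable, and leading coefficients satisfy the same equation in one variable fewer. *)
Lemma prod_1subX2_nonsquare k (b : pred nat) (p q : mp k) :
  has b (iota 1 k) ->
  p ^+ 2 = q ^+ 2 * \prod_(j <- iota 1 k | b j) (1 - Xv k j ^+ 2) -> q = 0.
Proof.
(* This product will be the constant [c], so it must be nonzero. If it vanished, p = 0 and q = 1
   would contradict the induction hypothesis; if [b] selects nothing it equals 1. *)
have nz i : (forall p q : mp i, has b (iota 1 i) ->
    p ^+ 2 = q ^+ 2 * \prod_(j <- iota 1 i | b j) (1 - Xv i j ^+ 2) -> q = 0) ->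
  \prod_(j <- iota 1 i | b j) (1 - Xv i j ^+ 2) != 0 :> mp i.
  move=> IH; have [hb|/hasPn hb] := boolP (has b (iota 1 i)).
    apply/eqP => D0; have := IH 0 1 hb; rewrite D0 mulr0 expr0n => /(_ erefl)/eqP.
    by rewrite oner_eq0.
  by rewrite big_seq_cond big1 ?oner_eq0 // => j /andP[/hb/negPf->].
elim: k p q => [|k IH] p q //; have D0 := nz _ IH.
have -> : iota 1 k.+1 = iota 1 k ++ [:: k.+1] by rewrite -{1}[k.+1]addn1 iotaD.
rewrite has_cat /= orbF; set D := (X in _ = _ * X) => hb E.
pose Dk := \prod_(j <- iota 1 k | b j) (1 - Xv k j ^+ 2).
have ED : D = (if b k.+1 then 1 - 'X ^+ 2 else 1) * (Dk%:P : {poly mp k}).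
  rewrite /D big_cat /= big_cons big_nil eqxx.
  rewrite mulrC; congr (_ * _); first by case: ifP; rewrite ?mulr1.
  rewrite rmorph_prod big_seq_cond [RHS]big_seq_cond; apply: eq_bigr => j /andP[].
  rewrite mem_iota add1n => /andP[_ jk] _.
  by rewrite (ltn_eqF jk) rmorphB rmorphXn rmorph1.
rewrite {}ED in E; case: ifP hb E => bk hb E.
  by apply: mul_1subX2_nonsquare E => //; rewrite mp_natr_eq0.
rewrite orbF in hb; apply/eqP; rewrite -lead_coef_eq0; apply/eqP.
apply: (IH (lead_coef p)) => //; rewrite -!lead_coef_exp E mul1r.
by rewrite lead_coefM lead_coefC.
Qed.

(** * Subfields and quadratic towers *)

Section Subfields.
Variable L : fieldType.
Implicit Types (K : L -> Prop) (s t : L -> L) (z w : L).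

Record is_subring K : Prop := IsSubring {
  subring1 : K 1;
  subringB : forall z w, K z -> K w -> K (z - w);
  subringM : forall z w, K z -> K w -> K (z * w) }.

Record is_subfield K : Prop := IsSubfield {
  subfield_ring :> is_subring K;
  subfieldV : forall z, K z -> K z^-1 }.

(** A total function on [L] stands for a map defined on [K]; apart from 0 and 1, only its values on
    [K] are constrained. *)
Record hom_on K s : Prop := HomOn {
  homD : forall z w, K z -> K w -> s (z + w) = s z + s w;
  homM : forall z w, K z -> K w -> s (z * w) = s z * s w;
  hom1 : s 1 = 1;
  hom0 : s 0 = 0 }.

Section SubringTheory.
Variables (K : L -> Prop) (Kr : is_subring K).

Lemma subring0 : K 0.
Proof. by rewrite -(subrr 1); apply: subringB (subring1 Kr) (subring1 Kr). Qed.

Lemma subringN z : K z -> K (- z).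
Proof. by rewrite -sub0r; apply: subringB => //; apply: subring0. Qed.

Lemma subringD z w : K z -> K w -> K (z + w).
Proof. by move=> Kz Kw; rewrite -[w]opprK; apply: subringB => //; apply: subringN. Qed.

Lemma subring_sum (I : Type) (r : seq I) (P : pred I) (F : I -> L) :
  (forall i, P i -> K (F i)) -> K (\sum_(i <- r | P i) F i).
Proof. by move=> KF; elim/big_ind: _ => //; [apply: subring0 | apply: subringD]. Qed.

Lemma subring_prod (I : eqType) (r : seq I) (P : pred I) (F : I -> L) :
  (forall i, i \in r -> P i -> K (F i)) -> K (\prod_(i <- r | P i) F i).
Proof.
move=> KF; rewrite big_seq_cond; elim/big_ind: _ => [|z w|i /andP[]].
- exact: subring1.
- exact: subringM.
- exact: KF.
Qed.

Lemma subringX z m : K z -> K (z ^+ m).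
Proof.
move=> Kz; elim: m => [|m IH]; first exact: subring1.
by rewrite exprS; apply: subringM.
Qed.

Lemma subring_sign (b : bool) z : K z -> K ((-1) ^+ b * z).
Proof. by case: b => Kz; rewrite ?mulN1r ?mul1r //; apply: subringN. Qed.

Lemma subring_int (m : int) : K m%:~R.
Proof.
have KN n : K n%:R.
  elim: n => [|n IH]; first exact: subring0.
  by rewrite mulrS; apply: subringD => //; apply: subring1.
by case: m => n; rewrite ?NegzE ?mulrNz -pmulrn //; apply: subringN.
Qed.

Lemma subring_coefM (p q : {poly L}) :
  (forall i, K p`_i) -> (forall i, K q`_i) -> forall i, K (p * q)`_i.
Proof.
by move=> Kp Kq i; rewrite coefM; apply: subring_sum => j _; apply: subringM.
Qed.

Lemma homN s z : hom_on K s -> K z -> s (- z) = - s z.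
Proof.
move=> hs Kz; apply/eqP; rewrite -addr_eq0 -(homD hs) ?addNr ?(hom0 hs) //.
exact: subringN.
Qed.

Lemma hom_prod s (I : eqType) (r : seq I) (P : pred I) (F : I -> L) :
  hom_on K s -> (forall i, i \in r -> P i -> K (F i)) ->
  s (\prod_(i <- r | P i) F i) = \prod_(i <- r | P i) s (F i).
Proof.
move=> hs; elim: r => [|i r IH] KF; first by rewrite !big_nil (hom1 hs).
have KF' j : j \in r -> P j -> K (F j) by move=> jr; apply: KF; rewrite inE jr orbT.
rewrite !big_cons; case: ifP => Pi; last exact: IH.
rewrite (homM hs) ?IH //; first by apply: KF; rewrite ?mem_head.
exact: subring_prod.
Qed.

Lemma hom_sum s (I : Type) (r : seq I) (P : pred I) (F : I -> L) :
  hom_on K s -> (forall i, P i -> K (F i)) ->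
  s (\sum_(i <- r | P i) F i) = \sum_(i <- r | P i) s (F i).
Proof.
move=> hs KF; elim: r => [|i r IH]; first by rewrite !big_nil (hom0 hs).
rewrite !big_cons; case: ifP => Pi; last exact: IH.
by rewrite (homD hs) ?IH //; [apply: KF | apply: subring_sum].
Qed.

End SubringTheory.

Lemma hom_inv K s z : is_subfield K -> hom_on K s -> K z -> s z^-1 = (s z)^-1.
Proof.
move=> Kf hs Kz; have [->|z0] := eqVneq z 0; first by rewrite invr0 (hom0 hs) invr0.
have sz : s z * s z^-1 = 1.
  by rewrite -(homM hs) ?divff ?(hom1 hs) //; apply: subfieldV.
have sz0 : s z != 0 by apply: contra_eq_neq sz => ->; rewrite mul0r eq_sym oner_eq0.
by apply: (mulfI sz0); rewrite sz divff.
Qed.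

Lemma hom_inj K s z w :
  is_subfield K -> hom_on K s -> K z -> K w -> s z = s w -> z = w.
Proof.
move=> Kf hs Kz Kw E; have Kr := subfield_ring Kf; have Kd : K (z - w) by apply: subringB.
apply/eqP; rewrite -subr_eq0; apply: contra_eqT (oner_neq0 L) => d0.
rewrite -(hom1 hs) -(divff d0) (homM hs) //; last exact: subfieldV.
rewrite (homD hs) ?(homN _ hs) //; last exact: subringN.
by rewrite E subrr mul0r eqxx.
Qed.

(** When [K] is a field containing y^2, this is the field K(y). *)
Definition adj K (y : L) : L -> Prop :=
  fun z => exists a b, [/\ K a, K b & z = a + b * y].

Lemma adj_sub K y z : is_subring K -> K z -> adj K y z.
Proof. by move=> Kr Kz; exists z, 0; rewrite mul0r addr0; split=> //; apply: subring0. Qed.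

Lemma adj_gen K y : is_subring K -> adj K y y.
Proof.
move=> Kr; exists 0, 1; rewrite mul1r add0r.
by split=> //; [apply: subring0 | apply: subring1].
Qed.

Lemma adj_subring K y : is_subring K -> K (y ^+ 2) -> is_subring (adj K y).
Proof.
move=> Kr Ky; split.
- by apply: adj_sub => //; apply: subring1.
- move=> _ _ [a [b [Ka Kb ->]]] [c [d [Kc Kd ->]]]; exists (a - c), (b - d).
  by split; [apply: subringB | apply: subringB | ring].
- move=> _ _ [a [b [Ka Kb ->]]] [c [d [Kc Kd ->]]].
  exists (a * c + b * d * y ^+ 2), (a * d + b * c).
  by split; [| |ring]; do ?[apply: subringD=> // | apply: subringM => //].
Qed.

(** If the norm a^2 - b^2 y^2 is nonzero, the inverse of a + b y is its conjugate over the norm. If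
    the norm is zero, then b = 0 or y is a/b up to sign, so a + b y already lies in [K]. *)
Lemma adj_subfield K y : is_subfield K -> K (y ^+ 2) -> is_subfield (adj K y).
Proof.
move=> Kf Ky; have Kr := subfield_ring Kf.
split=> [|_ [a [b [Ka Kb ->]]]]; first exact: adj_subring.
have [N0|N0] := eqVneq (a ^+ 2 - b ^+ 2 * y ^+ 2) 0; last first.
  have E : a ^+ 2 - b ^+ 2 * y ^+ 2 = (a + b * y) * (a - b * y) by ring.
  have KN : K (a ^+ 2 - b ^+ 2 * y ^+ 2)^-1.
    apply: subfieldV => //; apply: subringB => //; first exact: subringX.
    by apply: subringM => //; apply: subringX.
  exists (a / (a ^+ 2 - b ^+ 2 * y ^+ 2)), (- b / (a ^+ 2 - b ^+ 2 * y ^+ 2)).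
  split; do ?[by apply: subringM => //; apply: subringN | by apply: subringM].
  rewrite E in N0 *; move: N0; rewrite mulf_eq0 negb_or => /andP[u v].
  by apply: (mulfI u); rewrite divff //; field; rewrite u v.
apply: adj_sub => //; apply: subfieldV => //.
have [b0|b0] := eqVneq b 0; first by rewrite b0 mul0r addr0.
have : (a / b) ^+ 2 == y ^+ 2.
  rewrite expr_div_n; apply/eqP; apply: (canLR (mulfK _)); first by rewrite expf_neq0.
  by rewrite mulrC; apply/eqP; rewrite -subr_eq0 N0.
have Kab : K (a / b) by apply: subringM => //; apply: subfieldV.
rewrite eqf_sqr => /orP[] /eqP E; apply: subringD => //; apply: subringM => //.
  by rewrite -E.
by rewrite -[y]opprK -E; apply: subringN.
Qed.

(** As y is not in [K], the coordinates of a + b y are unique, so sending it to s(a) + s(b) y' is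
    well defined; the condition on y'^2 makes this multiplicative. *)
Lemma adj_hom K s y y' : is_subfield K -> hom_on K s -> K (y ^+ 2) -> ~ K y ->
  y' ^+ 2 = s (y ^+ 2) ->
  exists t, [/\ hom_on (adj K y) t, forall z, K z -> t z = s z & t y = y'].
Proof.
move=> Kf hs Ky nKy Ey; have Kr := subfield_ring Kf.
have uniq_rep a b c d : K a -> K b -> K c -> K d ->
    a + b * y = c + d * y -> a = c /\ b = d.
  move=> Ka Kb Kc Kd E; have [bd|bd] := eqVneq b d.
    by split=> //; move: E; rewrite bd => /addIr.
  case: nKy; have -> : y = (c - a) / (b - d).
    apply: (canRL (mulfK _)); first by rewrite subr_eq0.
    by rewrite mulrC mulrBl; apply/eqP; rewrite subr_eq addrAC -E addrAC subrr add0r.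
  apply: subringM => //; first exact: subringB.
  by apply: subfieldV => //; apply: subringB.
(* Membership in K(y) only asserts that coordinates exist, so the image is obtained by choice.
   Outside K(y) the specification is vacuous and 0 serves. *)
have ext z : {w | forall a b, K a -> K b -> z = a + b * y -> w = s a + s b * y'}.
  apply: constructive_indefinite_description.
  have [[a [b [Ka Kb ->]]]|nz] := classic (adj K y z).
    by exists (s a + s b * y') => c d Kc Kd /uniq_rep[] // -> ->.
  by exists 0 => a b Ka Kb E; case: nz; exists a, b.
pose t z := sval (ext z).
have tE a b : K a -> K b -> t (a + b * y) = s a + s b * y'.
  by move=> Ka Kb; rewrite /t; case: (ext _) => w /= /(_ a b Ka Kb erefl).
have ts z : K z -> t z = s z.
  move=> Kz; rewrite -[z in LHS]addr0 -(mul0r y) tE //; last exact: subring0.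
  by rewrite (hom0 hs) mul0r addr0.
exists t; split=> //; last first.
  rewrite -[y in LHS]add0r -[y in LHS]mul1r tE //; [|exact: subring0|exact: subring1].
  by rewrite (hom0 hs) (hom1 hs) add0r mul1r.
split.
- move=> _ _ [a [b [Ka Kb ->]]] [c [d [Kc Kd ->]]].
  rewrite [X in t X](_ : _ = (a + c) + (b + d) * y); last by ring.
  rewrite !tE ?(homD hs) //; do ?exact: subringD.
  by ring.
- move=> _ _ [a [b [Ka Kb ->]]] [c [d [Kc Kd ->]]].
  have Kac : K (a * c) by apply: subringM.
  have Kbd : K (b * d) by apply: subringM.
  have Kad : K (a * d) by apply: subringM.
  have Kbc : K (b * c) by apply: subringM.
  have Kbdy : K (b * d * y ^+ 2) by apply: subringM.
  rewrite [X in t X](_ : _ = (a * c + b * d * y ^+ 2) + (a * d + b * c) * y); last by ring.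
  rewrite !tE //; do ?exact: subringD.
  rewrite !(homD hs) // (homM hs Kbd Ky) (homM hs Ka Kc) (homM hs Kb Kd).
  by rewrite (homM hs Ka Kd) (homM hs Kb Kc) -Ey; ring.
- by rewrite ts ?(hom1 hs) //; apply: subring1.
- by rewrite ts ?(hom0 hs) //; apply: subring0.
Qed.

Section Tower.
Variable y : nat -> L.

Fixpoint tower K (js : seq nat) : L -> Prop :=
  if js is j :: js' then tower (adj K (y j)) js' else K.

Lemma tower_sub K js z : is_subring K -> (forall j, j \in js -> K (y j ^+ 2)) ->
  K z -> tower K js z.
Proof.
elim: js K => [|i js IH] K Kr Ky //= Kz.
have Kyi : K (y i ^+ 2) by apply: Ky; rewrite mem_head.
apply: IH; [exact: adj_subring | | exact: adj_sub].
by move=> j jin; apply: adj_sub => //; apply: Ky; rewrite inE jin orbT.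
Qed.

Lemma tower_gen K js j : is_subring K -> (forall j, j \in js -> K (y j ^+ 2)) ->
  j \in js -> tower K js (y j).
Proof.
elim: js K => [|i js IH] K Kr Ky //=.
have Kyi : K (y i ^+ 2) by apply: Ky; rewrite mem_head.
have Kyj k : k \in js -> adj K (y i) (y k ^+ 2).
  by move=> jin; apply: adj_sub => //; apply: Ky; rewrite inE jin orbT.
have Kr' : is_subring (adj K (y i)) by apply: adj_subring.
rewrite inE => /predU1P[->|]; last exact: IH.
by apply: tower_sub => //; apply: adj_gen.
Qed.

Lemma tower_subring K js : is_subring K -> (forall j, j \in js -> K (y j ^+ 2)) ->
  is_subring (tower K js).
Proof.
elim: js K => [|i js IH] K Kr Ky //=; apply: IH.
  by apply: adj_subring => //; apply: Ky; rewrite mem_head.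
by move=> j jin; apply: adj_sub => //; apply: Ky; rewrite inE jin orbT.
Qed.

Lemma tower_subfield K js : is_subfield K -> (forall j, j \in js -> K (y j ^+ 2)) ->
  is_subfield (tower K js).
Proof.
elim: js K => [|i js IH] K Kr Ky //=; apply: IH.
  by apply: adj_subfield => //; apply: Ky; rewrite mem_head.
by move=> j jin; apply: (adj_sub _ (subfield_ring Kr)); apply: Ky; rewrite inE jin orbT.
Qed.

(** * Independent square roots and their sign changes *)

(** When the y_j^2 lie in [K], this is the Kummer condition: no nonempty subproduct of the y_j^2 is
    a square in [K]. *)
Definition sqrt_indep K js := forall b : pred nat,
  has b js -> ~ K (\prod_(j <- js | b j) y j).

(** Suppose a product p of later roots equals a + c y_i with a, c in [K]. If a and c are nonzero,
    squaring expresses y_i in [K]; if c = 0 then p is in [K]; if a = 0 then y_i p is in [K]. Each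
    case contradicts independence over [K]. *)
Lemma sqrt_indep_adj K i js : [pchar L] =i pred0 -> is_subfield K ->
  uniq (i :: js) -> (forall j, j \in i :: js -> K (y j ^+ 2)) ->
  sqrt_indep K (i :: js) -> sqrt_indep (adj K (y i)) js.
Proof.
move=> L0 Kf /= /andP[ijs _] Ky ind b hb; have Kr := subfield_ring Kf; move=> [a [c [Ka Kc E]]].
set p := \prod_(_ <- _ | _) _ in E.
(* The value of [b] at i does not affect the product over [js], so it can be set freely: false makes
   the product over [i :: js] equal to p, true makes it y_i p. *)
have eqb (c0 : bool) : \prod_(j <- js | if j == i then c0 else b j) y j = p.
  rewrite /p big_seq_cond [RHS]big_seq_cond; apply: eq_bigl => j.
  by case jin: (j \in js) => //=; case: eqP jin ijs => // -> ->.
have hasb (c0 : bool) : has (fun j => if j == i then c0 else b j) js.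
  case/hasP: hb => j jin bj; apply/hasP; exists j => //.
  by case: eqP jin ijs => // -> ->.
have nKp : ~ K p.
  rewrite -(eqb false); have := ind (fun j => if j == i then false else b j).
  by rewrite /= big_cons eqxx; apply; rewrite hasb orbT.
have nKpy : ~ K (y i * p).
  rewrite -(eqb true); have := ind (fun j => if j == i then true else b j).
  by rewrite /= big_cons eqxx; apply.
have nKy : ~ K (y i).
  have := ind (fun j => j == i); rewrite /= big_cons eqxx /= big_seq_cond big1.
    by rewrite mulr1; apply.
  by move=> j /andP[jin /eqP ji]; rewrite ji (negPf ijs) in jin.
have Kyi : K (y i ^+ 2) by apply: Ky; rewrite mem_head.
have Kp2 : K (p ^+ 2).
  rewrite /p -prodrXl; apply: subring_prod => // j jin _.
  by apply: Ky; rewrite inE jin orbT.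
have [c0|c0] := eqVneq c 0; first by apply: nKp; rewrite E c0 mul0r addr0.
have [a0|a0] := eqVneq a 0.
  by apply: nKpy; rewrite E a0 add0r mulrCA -expr2; apply: subringM.
have two0 : 2%:R != 0 :> L by rewrite ((pcharf0P L).1 L0).
apply: nKy.
have -> : y i = (p ^+ 2 - a ^+ 2 - c ^+ 2 * y i ^+ 2) / (2%:R * a * c).
  by apply: (canRL (mulfK _)); [rewrite !mulf_neq0 | rewrite E; ring].
apply: subringM => //.
  apply: subringB => //; last by apply: subringM => //; apply: subringX.
  by apply: subringB => //; apply: subringX.
apply: subfieldV => //; do 2?apply: subringM => //.
exact: (subring_int Kf 2).
Qed.

(** The map is extended one root at a time by [adj_hom]; [sqrt_indep_adj] keeps the remaining roots
    independent over the enlarged field. *)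
Lemma tower_sign_hom K js s (e : nat -> bool) :
  [pchar L] =i pred0 -> is_subfield K -> hom_on K s -> uniq js ->
  (forall j, j \in js -> K (y j ^+ 2) /\ s (y j ^+ 2) = y j ^+ 2) ->
  sqrt_indep K js ->
  exists t, [/\ hom_on (tower K js) t, forall z, K z -> t z = s z
              & forall j, j \in js -> t (y j) = (-1) ^+ e j * y j].
Proof.
move=> L0; elim: js K s => [|i js IH] K s Kf hs ujs Ky ind; first by exists s.
have Kr := subfield_ring Kf.
have [Kyi syi] := Ky i (mem_head _ _).
have nKy : ~ K (y i).
  have := ind (fun j => j == i); rewrite /= big_cons eqxx /= big_seq_cond big1.
    by rewrite mulr1; apply.
  by case/andP: ujs => ijs _ j /andP[jin /eqP ji]; rewrite ji (negPf ijs) in jin.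
have [|t1 [ht1 t1s t1y]] := @adj_hom K s (y i) ((-1) ^+ e i * y i) Kf hs Kyi nKy.
  by rewrite exprMn sqrr_sign mul1r syi.
have [|||||t [ht tt1 ty]] := IH (adj K (y i)) t1.
- exact: adj_subfield.
- by [].
- by case/andP: ujs.
- move=> j jin; have [Kyj syj] : K (y j ^+ 2) /\ s (y j ^+ 2) = y j ^+ 2.
    by apply: Ky; rewrite inE jin orbT.
  by split; [apply: adj_sub | rewrite t1s].
- by apply: sqrt_indep_adj => // j /Ky[].
exists t; split=> //= [z Kz|j]; first by rewrite tt1 ?t1s //; apply: adj_sub.
rewrite inE => /predU1P[->|]; last exact: ty.
by rewrite tt1 ?t1y //; apply: adj_gen.
Qed.

(** * Transcendence over quadratic towers *)

Definition transc K (u : L) := forall p : {poly L},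
  (forall i, K p`_i) -> p.[u] = 0 -> p = 0.

(** A norm argument: write p = A + v B with A, B over [K]. The polynomial A^2 - v^2 B^2 = p (A - v
    B) is over [K] and vanishes at u, hence is zero and A = v B or A = - v B. In the first case p =
    2 A, so A vanishes at u and is zero; in the second p = 0. *)
Lemma transc_adj K v u : [pchar L] =i pred0 -> is_subring K -> K (v ^+ 2) ->
  transc K u -> transc (adj K v) u.
Proof.
move=> L0 Kr Kv Ku p Kp pu.
have rep i : {ab : L * L | [/\ K ab.1, K ab.2 & p`_i = ab.1 + ab.2 * v]}.
  apply: constructive_indefinite_description.
  by have [a [b ?]] := Kp i; exists (a, b).
pose A := \poly_(i < size p) (sval (rep i)).1.
pose B := \poly_(i < size p) (sval (rep i)).2.
have KA i : K A`_i.
  by rewrite coef_poly; case: ifP => _; [case: (rep i) => ? [] | apply: subring0].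
have KB i : K B`_i.
  by rewrite coef_poly; case: ifP => _; [case: (rep i) => ? [] | apply: subring0].
have pE : p = A + v *: B.
  apply/polyP => i; rewrite coefD coefZ !coef_poly; case: ltnP => ip.
    by case: (rep i) => ab /= [_ _ ->]; rewrite mulrC.
  by rewrite mulr0 addr0 nth_default.
have : A ^+ 2 - v ^+ 2 *: B ^+ 2 = 0.
  apply: Ku => [i|].
    rewrite coefB coefZ !expr2; apply: subringB => //; first exact: subring_coefM.
    by apply: subringM => //; apply: subring_coefM.
  have -> : A ^+ 2 - v ^+ 2 *: B ^+ 2 = p * (A - v *: B).
    by rewrite pE -!mul_polyC rmorphXn; ring.
  by rewrite hornerM pu mul0r.
rewrite -exprZn => /eqP; rewrite subr_eq0 eqf_sqr => /orP[] /eqP E.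
  have p2A : p = 2%:R * A by rewrite pE -E; ring.
  rewrite p2A (_ : A = 0) ?mulr0 //; apply: Ku => //.
  move/eqP: pu; rewrite p2A hornerM -polyC_natr hornerC mulf_eq0.
  by rewrite ((pcharf0P L).1 L0) => /eqP.
by rewrite pE E addNr.
Qed.

Lemma transc_tower K js u : [pchar L] =i pred0 -> is_subring K ->
  (forall j, j \in js -> K (y j ^+ 2)) -> transc K u -> transc (tower K js) u.
Proof.
move=> L0; elim: js K => [|i js IH] K Kr Ky Ku //=.
have Kyi : K (y i ^+ 2) by apply: Ky; rewrite mem_head.
apply: IH; [exact: adj_subring | | exact: transc_adj].
by move=> j jin; apply: adj_sub => //; apply: Ky; rewrite inE jin orbT.
Qed.

End Tower.
End Subfields.

(** * The Galois group of Q(x, y_i y_j) *)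

Section GeneratedFields.
Variable L : fieldType.
Implicit Types (K F E : L -> Prop) (s t : L -> L).

Lemma hom_id K : hom_on K id.
Proof. by []. Qed.

Lemma hom_on_sub K F s : (forall z, K z -> F z) -> hom_on F s -> hom_on K s.
Proof.
move=> KF hs; split; [| |exact: hom1 hs|exact: hom0 hs].
- by move=> z w /KF Fz /KF Fw; apply: (homD hs).
- by move=> z w /KF Fz /KF Fw; apply: (homM hs).
Qed.

Lemma hom_comp K F s t :
  hom_on K s -> hom_on F t -> (forall z, K z -> F (s z)) -> hom_on K (t \o s).
Proof.
move=> hs ht sKF; split=> [z w Kz Kw|z w Kz Kw| |] /=.
- by rewrite (homD hs) // (homD ht) //; apply: sKF.
- by rewrite (homM hs) // (homM ht) //; apply: sKF.
- by rewrite (hom1 hs) (hom1 ht).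
- by rewrite (hom0 hs) (hom0 ht).
Qed.

(** Together with [in_gen_field_min], this lets one check on generators that a morphism maps a
    generated field into [F]. *)
Lemma hom_preim_subfield K F s : is_subfield K -> is_subfield F -> hom_on K s ->
  is_subfield (fun z => K z /\ F (s z)).
Proof.
move=> Kf Ff hs; have Kr := subfield_ring Kf; have Fr := subfield_ring Ff.
split; first split.
- by split; [apply: subring1 | rewrite (hom1 hs); apply: subring1].
- move=> z w [Kz Fz] [Kw Fw]; split; first exact: subringB.
  rewrite (homD hs) ?(homN _ hs) //; last exact: subringN.
  exact: subringB.
- move=> z w [Kz Fz] [Kw Fw]; split; first exact: subringM.
  by rewrite (homM hs) //; apply: subringM.
- move=> z [Kz Fz]; split; first exact: subfieldV.
  by rewrite (hom_inv Kf hs) //; apply: subfieldV.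
Qed.

(** Together with [in_gen_field_min], this shows that morphisms agreeing on generators agree on the
    generated field. *)
Lemma hom_eq_subfield K s t : is_subfield K -> hom_on K s -> hom_on K t ->
  is_subfield (fun z => K z /\ s z = t z).
Proof.
move=> Kf hs ht; have Kr := subfield_ring Kf.
split; first split.
- by split; [apply: subring1 | rewrite (hom1 hs) (hom1 ht)].
- move=> z w [Kz Ez] [Kw Ew]; split; first exact: subringB.
  have KNw : K (- w) by apply: subringN.
  by rewrite (homD hs) ?(homN Kr hs) // (homD ht) ?(homN Kr ht) // Ez Ew.
- move=> z w [Kz Ez] [Kw Ew]; split; first exact: subringM.
  by rewrite (homM hs) // (homM ht) // Ez Ew.
- move=> z [Kz Ez]; split; first exact: subfieldV.
  by rewrite (hom_inv Kf hs) // (hom_inv Kf ht) // Ez.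
Qed.

Lemma subfield_meval K k (p : mp k) a : is_subfield K ->
  (forall i, (0 < i <= k)%N -> K (a i)) -> K (meval p a).
Proof.
move=> Kf; have Kr := subfield_ring Kf; elim: k p => [|k IH] p Ka /=.
  apply: subringM => //; first exact: subring_int.
  by apply: subfieldV => //; apply: subring_int.
apply: subring_sum => // i _; apply: subringM => //.
  by apply: IH => j /andP[j0 jk]; apply: Ka; rewrite j0 leqW.
by apply: subringX => //; apply: Ka; rewrite ltnSn.
Qed.

Lemma in_gen_field_min K gs z : is_subfield K -> (forall g, g \in gs -> K g) ->
  in_gen_field gs z -> K z.
Proof.
move=> Kf Kg [p [q [q0 ->]]]; have Kr := subfield_ring Kf.
have Ka i : (0 < i <= size gs)%N -> K (nth 0 gs i.-1).
  by case: i => //= i ig; apply: Kg; apply: mem_nth.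
apply: subringM => //; first exact: subfield_meval.
by apply: subfieldV => //; apply: subfield_meval.
Qed.

Hypothesis L0 : [pchar L] =i pred0.

Lemma in_gen_field_gen (gs : seq L) g : g \in gs -> in_gen_field gs g.
Proof.
move=> gg; exists (Xv _ (index g gs).+1), 1.
by rewrite /= (meval1 L0) // oner_eq0 (meval_Xv L0) //= ?nth_index ?divr1 ?index_mem.
Qed.

Lemma in_gen_field_subfield (gs : seq L) : is_subfield (in_gen_field gs).
Proof.
split; first split.
- by exists 1, 1; rewrite /= (meval1 L0) // oner_eq0 divr1.
- move=> _ _ [p [q [q0 ->]]] [p' [q' [q0' ->]]].
  exists (p * q' - p' * q), (q * q'); rewrite /= (mevalB L0) // !(mevalM L0) // mulf_neq0 //.
  by split=> //; rewrite -mulNr addf_div // mulNr.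
- move=> _ _ [p [q [q0 ->]]] [p' [q' [q0' ->]]]; exists (p * p'), (q * q').
  by rewrite /= !(mevalM L0) // mulf_neq0 // mulf_div.
- move=> _ [p [q [q0 ->]]].
  set a := fun i => _ in q0 *; have [p0|p0] := eqVneq (meval p a) 0.
    by exists 0, 1; rewrite p0 mul0r invr0 /= (meval0 L0) // (meval1 L0) // oner_eq0 mul0r.
  by exists q, p; split=> //; rewrite invf_div.
Qed.

(** Passes from evaluation at the list of generators to evaluation at [x] itself, where algebraic
    independence applies. *)
Lemma genKP (x : nat -> L) k z : in_gen_field (genK x k) z ->
  exists p q : mp k, meval q x != 0 /\ z = meval p x / meval q x.
Proof.
rewrite /in_gen_field; set a := fun i => nth 0 _ i.-1.
have ax i : (0 < i <= k)%N -> a i = x i.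
  case: i => //= i ik.
  by rewrite /a /= (nth_map 0%N) ?size_iota // nth_iota.
rewrite size_map size_iota => -[p [q /=]].
by rewrite !(eq_meval _ ax) => ?; exists p, q.
Qed.

Lemma genK_gen (x : nat -> L) k i : (0 < i <= k)%N -> in_gen_field (genK x k) (x i).
Proof. by move=> ik; apply/in_gen_field_gen/map_f; rewrite mem_iota add1n. Qed.

Lemma mem_genE_mul (x y : nat -> L) k i j : (0 < i)%N -> (i < j < k)%N ->
  y i * y j \in genE x y k.
Proof.
move=> i0 /andP[ij jk]; rewrite mem_cat; apply/orP; right; apply/mapP.
exists (i, j) => //; rewrite mem_filter ij /=; apply/allpairsP; exists (i, j).
by rewrite /= !mem_iota; split=> //; lia.
Qed.

Lemma genE_ind (x y : nat -> L) k (Q : L -> Prop) :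
  (forall i, (0 < i <= k)%N -> Q (x i)) ->
  (forall i j, (0 < i)%N -> (i < j < k)%N -> Q (y i * y j)) ->
  forall g, g \in genE x y k -> Q g.
Proof.
move=> Qx Qy g; rewrite mem_cat => /orP[/mapP[i]|/mapP[p]].
  by rewrite mem_iota add1n => ik ->; apply: Qx.
rewrite mem_filter => /andP[ij /allpairsP[[i j] /= [iI jI E]]] ->.
rewrite E /= in ij *; move: iI jI; rewrite !mem_iota => iI jI.
by apply: Qy; lia.
Qed.

(** If a product of the y_j were p/q at [x], squaring and algebraic independence would give the
    polynomial identity excluded by [prod_1subX2_nonsquare], forcing q = 0. *)
Lemma sqrt_indep_genK (x y : nat -> L) k : alg_indep k x ->
  (forall j, (1 <= j <= k)%N -> y j ^+ 2 = 1 - x j ^+ 2) ->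
  sqrt_indep y (in_gen_field (genK x k)) (iota 1 k.-1).
Proof.
move=> xi Hy b hb /genKP[p [q [q0 E]]].
(* The roots stop at y_{k-1} while the polynomials have k variables, so the index k is masked
   out. *)
pose b' j := b j && (j < k)%N.
have hb' : has b' (iota 1 k).
  case/hasP: hb => j; rewrite mem_iota => jk bj; apply/hasP; exists j.
    by rewrite mem_iota; lia.
  by rewrite /b' bj; lia.
have Eb : \prod_(j <- iota 1 k.-1 | b j) y j = \prod_(j <- iota 1 k | b' j) y j.
  rewrite /b' {}/b' in hb' *; case: k {xi Hy p q q0 E hb hb'} => [|m]; first by rewrite !big_nil.
  rewrite -[m.+1 in RHS]addn1 iotaD big_cat /= big_cons big_nil add1n addn1 ltnn andbF.
  rewrite mulr1 big_seq_cond [RHS]big_seq_cond; apply: eq_bigl => j.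
  by rewrite mem_iota; case: (b j); lia.
suff q00 : q = 0 by rewrite q00 (meval0 L0) ?eqxx in q0.
apply: (prod_1subX2_nonsquare (p := p) hb'); apply: (alg_indep_inj L0 xi).
rewrite (mevalM L0) // !expr2 !(mevalM L0) // (meval_prod L0) // -!expr2.
have -> : meval p x = \prod_(j <- iota 1 k | b' j) y j * meval q x.
  by rewrite -Eb E divfK.
rewrite exprMn -prodrXl mulrC; congr (_ * _); rewrite big_seq_cond [RHS]big_seq_cond.
apply: eq_bigr => j /andP[]; rewrite mem_iota add1n => jk _.
by rewrite (mevalB L0) // (meval1 L0) // !expr2 (mevalM L0) // (meval_Xv L0) // -!expr2 Hy.
Qed.

(** * Sign vectors and the enumeration of the Galois group *)

Lemma signr_inj_pchar0 : injective (fun b : bool => (-1) ^+ b : L).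
Proof.
have n11 : (1 == -1 :> L) = false.
  by rewrite -addr_eq0 -mulr2n ((pcharf0P L).1 L0).
by case=> [] [] //= /eqP; rewrite expr0 expr1 ?n11 // eq_sym n11.
Qed.

(** Vectors of length m + 1, with [false] for the sign + . Opposite vectors act alike on every y_i
    y_j, and fixing the first sign to + keeps one of each pair. Growing at the end puts vectors that
    differ in the last sign side by side, as the recursion requires. *)
Fixpoint signs (m : nat) : seq bitseq :=
  if m is m'.+1 then [seq rcons e b | e <- signs m', b <- [:: false; true]]
  else [:: [:: false]].

Lemma mem_signs m e :
  (e \in signs m) = (size e == m.+1) && ~~ nth false e 0.
Proof.
elim: m e => [|m IH] e; first by case: e => [|[] []].
apply/allpairsP/idP => [[[e' b] /= [e'm bb ->]]|].
  move: e'm; rewrite IH size_rcons eqSS => /andP[/eqP se ne].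
  by rewrite se eqxx nth_rcons se.
case/lastP: e => [|e b] //; rewrite size_rcons eqSS => /andP[/eqP se].
rewrite nth_rcons se /= => ne; exists (e, b); rewrite IH se eqxx ne.
by split=> //; case: b.
Qed.

Lemma uniq_signs m : uniq (signs m).
Proof.
elim: m => // m IH; apply: allpairs_uniq => // -[e b] [e' b'] _ _ /= /rcons_inj.
by [].
Qed.

(** Entry 0 of [e] is the sign of y_1, hence the shift; past the end of [e] the default [false]
    leaves y_j unchanged. *)
Definition flip (e : bitseq) (y : nat -> L) : nat -> L :=
  fun j => (-1) ^+ nth false e j.-1 * y j.

Lemma hom_EC (K F : L -> Prop) (x y : nat -> L) m t e :
  is_subring K -> is_subring F -> (forall z, K z -> F z) -> hom_on F t ->
  (forall z, K z -> t z = z) ->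
  (forall j, (0 < j <= m)%N -> K (x j)) ->
  (forall j, (0 < j <= m)%N -> F (y j) /\ t (y j) = flip e y j) ->
  t (EC x y m) = EC x (flip e y) m.
Proof.
move=> Kr Fr KF ht tK Kx Fy.
have Kc (l : nat) : K ((-1) ^+ l).
  by apply: subringX => //; apply: subringN => //; apply: subring1.
have Kpx (A : {set 'I_m}) : K (\prod_(j in A) x j.+1).
  by apply: subring_prod => // j _ _; apply: Kx; rewrite ltn_ord.
have FyS (j : 'I_m) : F (y j.+1) by case: (Fy j.+1); rewrite ?ltn_ord.
have Fpy (A : {set 'I_m}) : F (\prod_(j in A) y j.+1) by apply: subring_prod.
have Fcpy (l : nat) (A : {set 'I_m}) : F ((-1) ^+ l * \prod_(j in A) y j.+1).
  by apply: subringM => //; apply: KF.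
rewrite /EC (hom_sum Fr _ ht) ; last by move=> S _; apply: subringM => //; apply: KF.
apply: eq_bigr => S _; rewrite (homM ht) //; last exact: KF.
rewrite (homM ht) //; last exact: KF.
rewrite (tK _ (Kc _)) (tK _ (Kpx _)); congr (_ * _ * _); rewrite (hom_prod Fr ht) //.
by apply: eq_bigr => j _; case: (Fy j.+1); rewrite ?ltn_ord.
Qed.

(** Sign changes live on the tower K(y_1, ..., y_{k-1}) and restrict to the field generated by the
    y_i y_j. There an automorphism is determined by its signs on the y_1 y_j, which any sign vector
    starting with + realizes. Vectors in [signs k.-2] have one entry for each of y_1, ...,
    y_{k-1}. *)
Lemma G_enum_signs (x y : nat -> L) k : (1 < k)%N -> alg_indep k x ->
  (forall j, (1 <= j <= k)%N -> y j ^+ 2 = 1 - x j ^+ 2) ->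
  exists T : bitseq -> L -> L,
    G_enum x y k [seq T e | e <- signs k.-2] /\
    forall e, T e (EC x y k.-1) = EC x (flip e y) k.-1.
Proof.
move=> k1 xi Hy; pose K := in_gen_field (genK x k); pose js := iota 1 k.-1.
pose F := tower y K js; pose E := in_gen_field (genE x y k).
have Kf : is_subfield K by apply: in_gen_field_subfield.
have Ef : is_subfield E by apply: in_gen_field_subfield.
have Kr := subfield_ring Kf; have Er := subfield_ring Ef.
have jsE j : (j \in js) = (0 < j < k)%N by rewrite mem_iota; lia.
have Ky j : j \in js -> K (y j ^+ 2).
  rewrite jsE => jk; rewrite Hy; last by lia.
  apply: subringB => //; first exact: subring1.
  by apply: subringX => //; apply: genK_gen; lia.
have indep := sqrt_indep_genK xi Hy; rewrite -/K -/js in indep.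
have Ff : is_subfield F by apply: tower_subfield.
have Fr := subfield_ring Ff.
have KF z : K z -> F z by apply: tower_sub.
have Fy j : j \in js -> F (y j) by apply: tower_gen.
have Kx i : (0 < i <= k)%N -> K (x i) by apply: genK_gen.
have KE z : K z -> E z.
  apply: in_gen_field_min => // g /mapP[i]; rewrite mem_iota => ik ->.
  by apply: in_gen_field_gen; rewrite mem_cat map_f // mem_iota.
have EF z : E z -> F z.
  apply: in_gen_field_min => //; apply: genE_ind => [i ik|i j i0 ij].
    by apply: KF; apply: Kx.
  by apply: subringM => //; apply: Fy; rewrite jsE; lia.
have y0 j : j \in js -> y j != 0.
  move=> jin; apply/eqP => yj0; apply: (indep (pred1 j)).
    by apply/hasP; exists j => /=.
  rewrite -big_filter filter_pred1_uniq ?iota_uniq // big_seq1 yj0.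
  exact: subring0.
have TE e : {t | [/\ hom_on F t, forall z, K z -> t z = z
                   & forall j, j \in js -> t (y j) = flip e y j]}.
  apply: constructive_indefinite_description.
  apply: (@tower_sign_hom _ y K js id) => //; first exact: iota_uniq.
  by move=> j /Ky.
pose T e := sval (TE e).
have hT e : hom_on F (T e) by rewrite /T; case: (TE e) => t [].
have TK e z : K z -> T e z = z by rewrite /T; case: (TE e) => t [? + ?]; apply.
have Ty e j : j \in js -> T e (y j) = flip e y j.
  by rewrite /T; case: (TE e) => t [? ? +]; apply.
have TyM e i j : i \in js -> j \in js ->
    T e (y i * y j) = (-1) ^+ nth false e i.-1 * ((-1) ^+ nth false e j.-1 * (y i * y j)).
  by move=> iI jI; rewrite (homM (hT e) (Fy _ iI) (Fy _ jI)) !Ty // /flip; ring.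
have yyE i j : i \in js -> j \in js -> E (y i * y j).
  move=> iI jI; have [->|] := eqVneq i j; first by apply: KE; apply: Ky.
  rewrite neq_ltn => /orP[] ij; last rewrite mulrC.
    by apply: in_gen_field_gen; apply: mem_genE_mul; rewrite ?jsE in iI jI; lia.
  by apply: in_gen_field_gen; apply: mem_genE_mul; rewrite ?jsE in iI jI; lia.
have ET e z : E z -> E (T e z).
  move=> Ez; have [] : F z /\ E (T e z); last by [].
  apply: (in_gen_field_min (hom_preim_subfield Ff Ef (hT e)) _ Ez).
  apply: genE_ind => [i ik|i j i0 ij].
    have Kxi := Kx i ik.
    by split; [exact: KF | rewrite TK //; apply: KE].
  have iI : i \in js by rewrite jsE; lia.
  have jI : j \in js by rewrite jsE; lia.
  split; first by apply: EF; apply: yyE.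
  by rewrite TyM //; do 2!apply: subring_sign => //; apply: yyE.
have hTE e : hom_on E (T e) by apply: hom_on_sub EF (hT e).
(* A sign change is an involution, so it is its own inverse; this supplies surjectivity. *)
have TT e z : E z -> T e (T e z) = z.
  move=> Ez; have hTT := hom_comp (hTE e) (hTE e) (ET e).
  have [] : E z /\ (T e \o T e) z = id z; last by [].
  apply: (in_gen_field_min (hom_eq_subfield Ef hTT (hom_id E)) _ Ez).
  apply: genE_ind => [i ik|i j i0 ij].
    by split; [apply: KE; apply: Kx | rewrite /= !TK //; apply: Kx].
  have iI : i \in js by rewrite jsE; lia.
  have jI : j \in js by rewrite jsE; lia.
  split; first exact: yyE.
  have Tsgn (b : bool) w : F w -> T e ((-1) ^+ b * w) = (-1) ^+ b * T e w.
    by case: b => Fw; rewrite ?mul1r // !mulN1r (homN Fr (hT e)).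
  have Fyy : F (y i * y j) by apply: EF; apply: yyE.
  rewrite /= TyM // !Tsgn //; last exact: subring_sign.
  by rewrite TyM // (mulrCA (_ ^+ nth false _ j.-1)) !signrMK.
have yy0 j : j \in js -> y 1 * y j != 0.
  by move=> jI; rewrite mulf_neq0 ?y0 // jsE; lia.
have one_js : 1%N \in js by rewrite jsE.
have signs0 e : e \in signs k.-2 -> nth false e 0 = false.
  by rewrite mem_signs => /andP[_ /negPf].
exists T; split; last first.
  move=> e; apply: (hom_EC Kr Fr KF (hT e)) => [z|j jk|j jk]; first exact: TK.
    by apply: Kx; lia.
  have jI : j \in js by rewrite jsE; lia.
  by split; [apply: Fy | apply: Ty].
split; rewrite ?size_map.
- move=> i ik; rewrite (nth_map [::]) //; set e := nth _ _ i; split.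
  + exact: ET.
  + by move=> z w Ez Ew; split; [apply: (homD (hTE e)) | apply: (homM (hTE e))].
  + by rewrite (hom1 (hTE e)) (hom0 (hTE e)).
  + split=> [z w|w Ew]; first exact: hom_inj Ef (hTE e).
    by exists (T e w); [apply: ET | apply: TT].
  + exact: TK.
- move=> i j ik jk ij; rewrite !(nth_map [::]) //.
  set e := nth _ _ i; set e' := nth _ _ j => agr; apply: ij.
  have eI : e \in signs k.-2 by apply: mem_nth.
  have eI' : e' \in signs k.-2 by apply: mem_nth.
  apply/eqP; rewrite -(nth_uniq [::] ik jk (uniq_signs _)) -/e -/e'; apply/eqP.
  have [/eqP se _] := andP (etrans (esym (mem_signs _ _)) eI).
  have [/eqP se' _] := andP (etrans (esym (mem_signs _ _)) eI').
  apply: (@eq_from_nth _ false); first by rewrite se.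
  move=> l; rewrite se => lk; have lI : l.+1 \in js by rewrite jsE; lia.
  (* The first sign is +, so the sign on y_1 y_{l+1} is exactly entry l of the vector. *)
  have := agr _ (yyE _ _ one_js lI); rewrite !TyM //= !signs0 // !expr0 !mul1r.
  by move/(mulIf (yy0 _ lI)); apply: signr_inj_pchar0.
- move=> s [sE sDM [s1 s0] _ sK].
  have hs : hom_on E s by split=> // z w Ez Ew; case: (sDM z w Ez Ew).
  (* The square of y_1 y_j lies in [K] and is fixed by s, so s can only change the sign of y_1
     y_j. *)
  have sw j : j \in js -> s (y 1 * y j) = (-1) ^+ (s (y 1 * y j) != y 1 * y j) * (y 1 * y j).
    move=> jI; have Eyy := yyE _ _ one_js jI; have : s (y 1 * y j) ^+ 2 = (y 1 * y j) ^+ 2.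
      rewrite expr2 -(homM hs) // -expr2 exprMn sK //.
      by apply: subringM => //; apply: Ky.
    move/eqP; rewrite eqf_sqr; case: eqVneq => [-> _|_ /= /eqP ->].
      by rewrite mul1r.
    by rewrite mulN1r.
  (* The vector is read off from s; its first entry is [false] because y_1^2 lies in [K]. *)
  pose e := [seq s (y 1 * y j) != y 1 * y j | j <- js].
  have eI : e \in signs k.-2.
    rewrite mem_signs size_map size_iota (nth_map 0%N) ?size_iota ?nth_iota; try lia.
    rewrite addn0 negbK sK ?eqxx ?andbT; first by lia.
    by rewrite -expr2; apply: Ky.
  exists (index e (signs k.-2)); first by rewrite index_mem.
  rewrite (nth_map [::]) ?index_mem // nth_index // => z Ez.
  have eqf := hom_eq_subfield Ef hs (hTE e).
  have eqw j : j \in js -> E (y 1 * y j) /\ s (y 1 * y j) = T e (y 1 * y j).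
    move=> jI; split; first exact: yyE.
    rewrite TyM // /= signs0 // expr0 mul1r sw //; congr (_ ^+ _ * _).
    rewrite jsE in jI; rewrite (nth_map 0%N) ?size_iota ?nth_iota; try lia.
    by rewrite add1n prednK //; lia.
  have [] : E z /\ s z = T e z; last by [].
  apply: (in_gen_field_min eqf _ Ez); apply: genE_ind => [i ik|i j i0 ij].
    by have Kxi := Kx i ik; split; [apply: KE | rewrite sK // TK].
  have iI : i \in js by rewrite jsE; lia.
  have jI : j \in js by rewrite jsE; lia.
  (* All generators y_i y_j are recovered from the y_1 y_j, on which s and [T e] already agree. *)
  have -> : y i * y j = (y 1 * y i) * (y 1 * y j) * (y 1 ^+ 2)^-1.
    by field; apply: y0.
  apply: (subringM eqf); first by apply: (subringM eqf); apply: eqw.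
  by apply: (subfieldV eqf); rewrite expr2; apply: eqw.
Qed.

(** EC_m is the cosine of a sum of angles with cosines x_j and sines y_j, and the two products are
    its conjugate exponentials. Expanding both over subsets, odd subsets cancel and even ones
    double. *)
Lemma EC_double (x y : nat -> L) m (i : L) : i ^+ 2 = -1 ->
  EC x y m *+ 2 = \prod_(j < m) (x j.+1 + i * y j.+1)
                  + \prod_(j < m) (x j.+1 - i * y j.+1).
Proof.
move=> i2.
have expand c : \prod_(j < m) (x j.+1 + c * y j.+1) =
    \sum_(S : {set 'I_m}) c ^+ #|S| * (\prod_(j in S) y j.+1) * (\prod_(j in ~: S) x j.+1).
  under eq_bigr do rewrite addrC; rewrite bigA_distr; apply: eq_bigr => S _.
  rewrite (bigID (mem S)) /=; congr (_ * _).
    under eq_bigr => j jS do rewrite jS.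
    by rewrite big_split /= prodr_const.
  under eq_bigr => j /negPf jS do rewrite jS.
  by apply: eq_bigl => j; rewrite inE.
have := expand (- i); under eq_bigr do rewrite mulNr; move=> ->; rewrite expand -big_split /=.
rewrite (bigID (fun S : {set _} => ~~ odd #|S|)) /= [X in _ = _ + X]big1 ?addr0.
  rewrite -sumrMnl; apply: eq_bigr => S /negPf oS.
  rewrite (exprNn i) -(signr_odd _ #|S|) oS mul1r -mulr2n; congr (_ * _ * _ *+ 2).
  by rewrite -[in RHS](odd_double_half #|S|) oS add0n -mul2n exprM i2.
by move=> S; rewrite negbK => oS; rewrite (exprNn i) -(signr_odd _ #|S|) oS expr1 !mulNr mul1r subrr.
Qed.

End GeneratedFields.

(** * The recursion *)

Section Recursion.
Variable L : fieldType.
Hypothesis L0 : [pchar L] =i pred0.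

(** The ring Q[x_1, ..., x_m] inside [L]. Working with the ring lets coefficients be lifted back to
    [mp m] without denominators. *)
Definition poly_values (x : nat -> L) (m : nat) (z : L) : Prop :=
  exists p : mp m, z = meval p x.

Lemma poly_values_subring x m : is_subring (poly_values x m).
Proof.
split; first by exists 1; rewrite (meval1 L0).
- by move=> _ _ [p ->] [q ->]; exists (p - q); rewrite (mevalB L0).
- by move=> _ _ [p ->] [q ->]; exists (p * q); rewrite (mevalM L0).
Qed.

Lemma poly_values_Xv x m i : (0 < i <= m)%N -> poly_values x m (x i).
Proof. by move=> im; exists (Xv m i); rewrite (meval_Xv L0). Qed.

(** Lifting each coefficient to [mp m] yields an element of [mp m.+1] that vanishes at [x], hence is
    zero. *)
Lemma transc_poly_values x m :
  alg_indep m.+1 x -> transc (poly_values x m) (x m.+1).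
Proof.
move=> xi p Kp px.
have c i : {c : mp m | p`_i = meval c x}.
  exact: constructive_indefinite_description (Kp i).
pose q : {poly mp m} := \poly_(i < size p) sval (c i).
have qE : map_poly (fun c => meval c x) q = p.
  apply/polyP => i; rewrite coef_map_id0 ?(meval0 L0) // coef_poly.
  by case: ltnP => ip; [case: (c i) | rewrite (meval0 L0) nth_default].
have q0 : q = 0 by apply: (xi q); rewrite mevalE qE.
by rewrite -qE q0; apply/polyP => i; rewrite coef_map_id0 ?(meval0 L0) // !coef0 (meval0 L0).
Qed.

Lemma subring_EC (F : L -> Prop) (x y : nat -> L) m : is_subring F ->
  (forall j, (0 < j <= m)%N -> F (x j)) -> (forall j, (0 < j <= m)%N -> F (y j)) ->
  F (EC x y m).
Proof.
move=> Fr Fx Fy; apply: subring_sum => // S _.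
apply: subringM => //; first apply: subringM => //.
- by apply: subringX => //; apply: subringN => //; apply: subring1.
- by apply: subring_prod => // j _ _; apply: Fy; rewrite ltn_ord.
- by apply: subring_prod => // j _ _; apply: Fx; rewrite ltn_ord.
Qed.

(* An identity at the generic point [x m.+1] is a polynomial identity in the
   last variable, since that point is transcendental over Q(x_j, y_j : j <= m). *)
Lemma meval_last_generic (x y : nat -> L) m (p : mp m.+1) (es : seq bitseq) u a :
  alg_indep m.+1 x ->
  (forall j, (1 <= j <= m)%N -> y j ^+ 2 = 1 - x j ^+ 2) ->
  meval p x = \prod_(e <- es) (x m.+1 - EC x (flip e y) m) ->
  (forall i, (0 < i <= m)%N -> a i = x i) -> a m.+1 = u ->
  meval p a = \prod_(e <- es) (u - EC x (flip e y) m).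
Proof.
move=> xi Hy px ax au; pose K := poly_values x m; pose F := tower y K (iota 1 m).
have Kr : is_subring K by apply: poly_values_subring.
have Ky j : j \in iota 1 m -> K (y j ^+ 2).
  rewrite mem_iota add1n => jm; rewrite Hy; last by [].
  apply: subringB => //; first exact: subring1.
  by apply: subringX => //; apply: poly_values_Xv.
have Fr : is_subring F by apply: tower_subring.
have KF z : K z -> F z by apply: tower_sub.
have Fu : transc F (x m.+1) by apply: transc_tower => //; apply: transc_poly_values.
pose q := map_poly (fun c => meval c x) (p : {poly mp m}).
pose r := \prod_(e <- es) ('X - (EC x (flip e y) m)%:P).
have rE v : r.[v] = \prod_(e <- es) (v - EC x (flip e y) m).
  by rewrite horner_prod; apply: eq_bigr => e _; rewrite hornerXsubC.
(* All sign-changed values lie in the one tower [F], so a single transcendence statement covers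
   every factor. *)
have FEC e : F (EC x (flip e y) m).
  apply: subring_EC => // j jm; first by apply: KF; apply: poly_values_Xv.
  by apply: subring_sign => //; apply: tower_gen; rewrite ?mem_iota.
have Fr_coef i : F r`_i.
  rewrite /r; elim/big_ind: _ i => [i|f g Ff Fg i|e _ i].
  - by by rewrite coef1; case: eqP => _; [apply: subring1 | apply: subring0].
  - exact: subring_coefM.
  - rewrite coefB coefX coefC; apply: subringB => //.
      by case: eqP => _; [apply: subring1 | apply: subring0].
    by case: eqP => // _; apply: subring0.
have Fq_coef i : F q`_i.
  by rewrite coef_map_id0 ?(meval0 L0) //; apply: KF; exists (p : {poly mp m})`_i.
have qr : q = r.
  apply/eqP; rewrite -subr_eq0; apply/eqP/Fu => [i|].
    by rewrite coefB; apply: subringB.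
  by rewrite hornerD hornerN rE -px mevalE subrr.
rewrite mevalE au -rE -qr; congr (_.[_]).
by apply: eq_map_poly => c; apply: eq_meval.
Qed.

(** With t = cos T, x_{m+1} = cos A and EC_m = cos B, this is (cos T - cos(B+A)) (cos T - cos(B-A))
    = (cos(A+T) - cos B) (cos(A-T) - cos B). Both sides equal t^2 + a^2 + c^2 - 1 - 2 t a c, where a
    = cos A and c = cos B. *)
Lemma EC_rcons_mul (x y : nat -> L) m (e : bitseq) (i t w : L) :
  i ^+ 2 = -1 -> size e = m ->
  (forall j, (1 <= j <= m.+1)%N -> y j ^+ 2 = 1 - x j ^+ 2) ->
  w ^+ 2 = 1 - t ^+ 2 ->
  (t - EC x (flip (rcons e false) y) m.+1) * (t - EC x (flip (rcons e true) y) m.+1)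
  = (x m.+1 * t - y m.+1 * w - EC x (flip e y) m)
    * (x m.+1 * t + y m.+1 * w - EC x (flip e y) m).
Proof.
move=> i2 se Hy Hw.
pose Z := \prod_(j < m) (x j.+1 + i * flip e y j.+1).
pose W := \prod_(j < m) (x j.+1 - i * flip e y j.+1).
have ZW : Z * W = 1.
  rewrite /Z /W -big_split big1 // => j _ /=.
  have -> : (x j.+1 + i * flip e y j.+1) * (x j.+1 - i * flip e y j.+1)
      = x j.+1 ^+ 2 - i ^+ 2 * flip e y j.+1 ^+ 2 by ring.
  have -> : flip e y j.+1 ^+ 2 = y j.+1 ^+ 2 by rewrite exprMn sqrr_sign mul1r.
  have -> : y j.+1 ^+ 2 = 1 - x j.+1 ^+ 2 by apply: Hy; rewrite /= ltnW // ltnS.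
  by rewrite i2; ring.
have ECe : EC x (flip e y) m *+ 2 = Z + W by apply: EC_double.
have flip_lt b (j : 'I_m) : flip (rcons e b) y j.+1 = flip e y j.+1.
  by rewrite /flip /= nth_rcons se ltn_ord.
have ECb b : EC x (flip (rcons e b) y) m.+1 *+ 2 =
    Z * (x m.+1 + i * ((-1) ^+ b * y m.+1)) + W * (x m.+1 - i * ((-1) ^+ b * y m.+1)).
  rewrite (EC_double _ _ _ i2) !big_ord_recr /= {2 4}/flip /= nth_rcons se ltnn eqxx.
  by congr (_ * _ + _ * _); apply: eq_bigr => j _; rewrite flip_lt.
have two0 : 2%:R != 0 :> L by rewrite ((pcharf0P L).1 L0).
have half (u v : L) : u *+ 2 = v -> u = v / 2%:R.
  by move=> uv; apply: (canRL (mulfK two0)); rewrite mulr_natr.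
rewrite (half _ _ ECe) (half _ _ (ECb false)) (half _ _ (ECb true)).
have Hv := Hy m.+1 (leqnn _); rewrite /= expr0 expr1.
set a := x m.+1 in Hv *; set v := y m.+1 in Hv *.
apply: (mulfI (mulf_neq0 two0 two0)).
apply/eqP; rewrite -subr_eq0; apply/eqP.
(* Four times the difference of the two sides, written as an explicit combination of the relations
   i^2 = -1, v^2 = 1 - a^2, w^2 = 1 - t^2 and Z W = 1. *)
transitivity ((1 + i ^+ 2) * (- (Z - W) ^+ 2 * v ^+ 2)
  + (v ^+ 2 - (1 - a ^+ 2)) * ((Z - W) ^+ 2 + 4%:R * w ^+ 2)
  + 4%:R * (1 - a ^+ 2) * (w ^+ 2 - (1 - t ^+ 2))
  + 4%:R * (a ^+ 2 - 1) * (Z * W - 1)); first by field.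
by rewrite i2 Hv Hw ZW !subrr; ring.
Qed.

End Recursion.

(** * Assembly: the first cases, the recursion and uniqueness *)

Theorem mainTheorem6 (L : closedFieldType) (n : nat) (x y : nat -> L)
  (P : forall k : nat, mp k)
  (Hchar : [pchar L] =i pred0)
  (Hind : alg_indep n x)
  (Hy : forall j, (1 <= j <= n)%N -> y j ^+ 2 = 1 - x j ^+ 2)
  (HP1 : P 1%N = Xv 1 1 - 1)
  (HPk : forall k, (2 <= k <= n)%N -> forall ss, G_enum x y k ss ->
           meval (P k) x = \prod_(s <- ss) (x k - s (EC x y k.-1))) :
  [/\ (2 <= n)%N -> P 2%N = Xv 2 2 - Xv 2 1,
      forall m, (3 <= m <= n)%N ->
        meval (P m) x = meval (P m.-1) (rec_pt x y m (-1))
                        * meval (P m.-1) (rec_pt x y m 1)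
    & forall Q : forall k : nat, mp k,
        Q 1%N = Xv 1 1 - 1 ->
        ((2 <= n)%N -> Q 2%N = Xv 2 2 - Xv 2 1) ->
        (forall m, (3 <= m <= n)%N ->
           meval (Q m) x = meval (Q m.-1) (rec_pt x y m (-1))
                           * meval (Q m.-1) (rec_pt x y m 1)) ->
        forall k, (1 <= k <= n)%N -> Q k = P k].
Proof.
have [i i2] := imaginary_exists L.
have PE k : (2 <= k <= n)%N -> meval (P k) x =
    \prod_(e <- signs k.-2) (x k - EC x (flip e y) k.-1).
  move=> /andP[k2 kn]; have xk := alg_indep_leq Hchar kn Hind.
  have [|T [TG TEC]] := G_enum_signs Hchar k2 xk (y := y).
    by move=> j jk; apply: Hy; lia.
  rewrite (HPk k _ _ TG) ?k2 // big_map; apply: eq_bigr => e _.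
  by rewrite TEC.
(* [signs 0] is the single vector with sign +, so the product is x_2 - EC_1; doubling shows EC_1 =
   x_1. *)
have P2 : (2 <= n)%N -> P 2%N = Xv 2 2 - Xv 2 1.
  move=> n2; apply: (alg_indep_inj Hchar (alg_indep_leq Hchar n2 Hind)).
  rewrite PE ?n2 // (mevalB Hchar) !(meval_Xv Hchar) //= big_seq1; congr (_ - _).
  have two0 : 2%:R != 0 :> L by rewrite ((pcharf0P L).1 Hchar).
  apply: (mulIf two0); rewrite !mulr_natr (EC_double _ _ _ i2) !big_ord1 mulr2n.
  by rewrite addrACA subrr addr0.
have rec m : (3 <= m <= n)%N -> meval (P m) x =
    meval (P m.-1) (rec_pt x y m (-1)) * meval (P m.-1) (rec_pt x y m 1).
  case: m => [|[|[|N]]] // mn; have Nn : (N.+3 <= n)%N by lia.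
  have xN : alg_indep N.+2 x by apply: alg_indep_leq Hind => //; apply: ltnW.
  (* [rec_pt] alters only the last variable of P_{N+2}, so the sign product at the generic point
     carries over to the new argument. *)
  have PN e : meval (P N.+2) (rec_pt x y N.+3 e) = \prod_(s <- signs N)
      (x N.+2 * x N.+3 + e * (y N.+2 * y N.+3) - EC x (flip s y) N.+1).
    apply: (meval_last_generic Hchar xN).
    - by move=> j jN; apply: Hy; lia.
    - by rewrite PE //; lia.
    - by move=> j jN; rewrite /rec_pt /= ltn_eqF //; lia.
    - by rewrite /rec_pt /= eqxx.
  (* Each vector of [signs N] has two extensions in [signs N.+1]; their factors are paired and
     [EC_rcons_mul] is applied with t = x_{N+3} and w = y_{N+3}. *)
  rewrite PE // -[N.+3.-1]/N.+2 !PN -big_split big_allpairs_dep.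
  rewrite big_seq [RHS]big_seq; apply: eq_bigr => e; rewrite mem_signs => /andP[/eqP se _].
  rewrite big_cons big_seq1 /= mulN1r mul1r (EC_rcons_mul Hchar i2 se (w := y N.+3)) //.
    by move=> j jN; apply: Hy; lia.
  by apply: Hy; lia.
split=> // Q Q1 Q2 Qrec; elim=> [|[|[|k]] IH] // kn.
- by rewrite Q1 HP1.
- by rewrite Q2 ?P2.
(* From index 3 on, the recursion gives both polynomials the same value at the generic point, and
   algebraic independence turns this into equality. *)
apply: (alg_indep_inj Hchar (alg_indep_leq Hchar _ Hind)); first by case/andP: kn.
by rewrite Qrec // rec // IH //; lia.
Qed.
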